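(* Let $p,q\in\mathbb{N}$ be multiplicatively independent integers. Then the set $\{k!\,p^m q^n \colon k,m,n\in\mathbb{N}\}$ is a set of Bohr recurrence.
   Context: $\mathbb{N}$ denotes the set of positive integers and $\mathbb{T}=\mathbb{R}/\mathbb{Z}$. For $x\in\mathbb{R}$, $\|x\|_{\mathbb{T}}$ denotes the distance from $x$ to the nearest integer. Two integers $p,q\ge 2$ are multiplicatively independent if their only common power is $1$, i.e. there are no $a,b\in\mathbb{N}$ with $p^a=q^b$. A subset $R$ of the integers is a set of Bohr recurrence if for every $d\in\mathbb{N}$, all $\alpha_1,\dots,\alpha_d\in\mathbb{R}$, and every $\varepsilon>0$, there exists a non-zero $r\in R$ such that $\|r\alpha_j\|_{\mathbb{T}}\le\varepsilon$ for $j=1,\dots,d$. *)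

(* Defs.v *)
From mathcomp Require Import all_boot all_order all_algebra.
From mathcomp Require Import boolp classical_sets reals.

Set Implicit Arguments.
Unset Strict Implicit.
Unset Printing Implicit Defensive.

Import Order.TTheory GRing.Theory Num.Theory.

Local Open Scope classical_set_scope.
Local Open Scope ring_scope.

(* The infimum is over a nonempty set bounded below by 0, so the junk value
   of [inf] never occurs; it is attained at a nearest integer. *)
Definition dist_int (R : realType) (x : R) : R :=
  inf [set `|x - z%:~R| | z in [set: int]].

Definition mult_independent (p q : nat) : Prop :=
  ~ exists a b : nat, [/\ (0 < a)%N, (0 < b)%N & (p ^ a = q ^ b)%N].

Definition bohr_recurrence (R : realType) (S : set int) : Prop :=
  forall (d : nat) (alpha : 'I_d -> R) (eps : R),
    (0 < d)%N -> 0 < eps ->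
    exists r : int,
      [/\ S r, r != 0 & forall j : 'I_d, dist_int (r%:~R * alpha j) <= eps].

Definition fact_pow_set (p q : nat) : set int :=
  [set r | exists k m n : nat,
     [/\ (0 < k)%N, (0 < m)%N, (0 < n)%N & r = (k`! * p ^ m * q ^ n)%N%:Z]].

(* Main.v *)
Require Import Defs.
From mathcomp Require Import all_boot all_order all_algebra.
From mathcomp Require Import boolp classical_sets reals.
From mathcomp Require Import topology normedtype cyclic.
From mathcomp Require Import lra ring zify.

Set Implicit Arguments.
Unset Strict Implicit.
Unset Printing Implicit Defensive.

Import Order.TTheory GRing.Theory Num.Theory.
Import numFieldTopology.Exports numFieldNormedType.Exports.

Local Open Scope classical_set_scope.
Local Open Scope ring_scope.

(** Write [alpha] as a row vector [v], and work with the closed subsets of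
R^d that are stable under translation by Z^d and under multiplication by [p]
and by [q].  These are the closed [p, q]-invariant subsets of the torus T^d.
The closure [O] of the points [p ^ m * q ^ n * v + z], with [z] integral, is
one of them.  The key fact ([torsion_point_in_invariant]) is that every
nonempty such set contains a torsion point [y], that is, a point with [N * y]
integral for some [N >= 1].  For [y] in [O], some [p ^ m * q ^ n * v] is close
to [y] modulo Z^d, hence [N! * p ^ m * q ^ n * v] is close to Z^d, which is the
claim with [k = N].

To find a torsion point, suppose that [X] is invariant and has none.  The
argument extends the one of Furstenberg for the circle.

- The orbit of a point of [X] under [p] is infinite modulo Z^d, so [X - X]
  contains arbitrarily small nonzero vectors [u] ([small_difference]).

- As [p] and [q] are multiplicatively independent, consecutive integers of the
  form [p ^ i * q ^ j] have ratio tending to 1 ([lacunary]).  Hence the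
  multiples of a very small [u] by these integers follow the ray spanned by [u]
  closely.  By the theorem of Dirichlet on simultaneous approximation this ray
  passes near nonzero integral vectors [c], and, after division by a power of
  [t], near vectors [c / t] with [c] not divisible by [t].  By compactness,
  [X - X] contains some nonzero [t]-torsion vector [c / t] modulo Z^d
  ([torsion_difference]).

- Let [t] be a prime not dividing [p * q].  Some powers [p ^ a] and [q ^ a] are
  1 modulo [t], so the set of [x] such that [x + s] is in [X] for all [s] in a
  given set [T] of [t]-torsion points is again closed and invariant, under
  these powers.  Take [T] maximal such that this set is not empty.  A torsion
  difference of this set stabilizes [T], so [T] contains a subgroup of order
  [t].  Some coordinate takes all the values [j / t] on this subgroup, so some
  point of [X] has that coordinate within [1 / t] of an integer
  ([coordinate_near_int]).

- As [t] grows, compactness gives a point of [X] with an integral coordinate.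
  Apply this to the points of [X] whose coordinates in a set [Z] are integral,
  with [Z] maximal such that there are any: it produces a coordinate outside
  [Z], which is absurd. *)

(** * Vectors modulo the integral lattice *)

Lemma coord_le_norm (R : realType) d (x : 'rV[R]_d) i : `|x 0 i| <= `|x|.
Proof.
rewrite [leRHS]/Num.norm /= mx_normrE.
exact: (le_bigmax _ (fun ij : 'I_1 * 'I_d => `|x ij.1 ij.2|) (0, i)).
Qed.

Lemma norm_rV_lt (R : realType) d (x : 'rV[R]_d) e :
  0 < e -> (forall i, `|x 0 i| < e) -> `|x| < e.
Proof.
move=> e0 xe; rewrite [ltLHS]/Num.norm /= mx_normrE.
by apply/bigmax_ltP; split=> // -[i j] _ /=; rewrite ord1.
Qed.

Definition integral_rV (R : realType) d (x : 'rV[R]_d) :=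
  forall i, x 0 i \is a Num.int.

Lemma integralD (R : realType) d (x y : 'rV[R]_d) :
  integral_rV x -> integral_rV y -> integral_rV (x + y).
Proof. by move=> xi yi i; rewrite mxE rpredD. Qed.

Lemma integralB (R : realType) d (x y : 'rV[R]_d) :
  integral_rV x -> integral_rV y -> integral_rV (x - y).
Proof. by move=> xi yi i; rewrite !mxE rpredB. Qed.

Lemma integralZ (R : realType) d a (x : 'rV[R]_d) :
  a \is a Num.int -> integral_rV x -> integral_rV (a *: x).
Proof. by move=> ai xi i; rewrite mxE rpredM. Qed.

Lemma integral_map (R : realType) d (c : 'rV[int]_d) :
  integral_rV (map_mx intr c : 'rV[R]_d).
Proof. by move=> i; rewrite mxE intr_int. Qed.

Lemma integral_rVP (R : realType) d (z : 'rV[R]_d) :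
  integral_rV z -> exists c : 'rV[int]_d, z = map_mx intr c.
Proof.
move=> zi; exists (map_mx Num.floor z); apply/rowP => j.
by rewrite !mxE; case/intrP: (zi j) => m ->; rewrite intrKfloor.
Qed.

Definition frac_rV (R : realType) d (x : 'rV[R]_d) : 'rV[R]_d :=
  \row_i (x 0 i - (Num.floor (x 0 i))%:~R).

Lemma frac_rV_int (R : realType) d (x : 'rV[R]_d) :
  integral_rV (frac_rV x - x).
Proof. by move=> i; rewrite !mxE addrAC subrr add0r rpredN intr_int. Qed.

Lemma frac_rV_inj (R : realType) d (x y : 'rV[R]_d) :
  frac_rV x = frac_rV y -> integral_rV (x - y).
Proof.
move=> xy; have := integralB (frac_rV_int y) (frac_rV_int x).
by rewrite xy opprB addrC addrA subrK.
Qed.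

Lemma frac_rV_itv (R : realType) d (x : 'rV[R]_d) i :
  0 <= frac_rV x 0 i < 1.
Proof. by rewrite mxE; have := floor_itv (x 0 i); rewrite intrD; lra. Qed.

(** The pigeonhole principle for the partition of the unit cube into
[M ^ d] cubes of side [1 / M].  The bound [l <= M ^ d] does not depend on [f]:
this uniformity matters when [f] is the sequence of multiples of a direction
over which one has no control. *)
Lemma pigeonhole_frac (R : realType) d M (f : nat -> 'rV[R]_d) :
  (0 < M)%N -> exists k l, [/\ (k < l)%N, (l <= M ^ d)%N &
    `|frac_rV (f l) - frac_rV (f k)| < M%:R^-1].
Proof.
move=> M0; have M0R : 0 < M%:R :> R by rewrite ltr0n.
pose b n i := Num.trunc (M%:R * frac_rV (f n) 0 i).
have bP n i : (b n i < M)%N.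
  have /andP[f0 f1] := frac_rV_itv (f n) i.
  have := @truncn_itv _ (M%:R * frac_rV (f n) 0 i).
  rewrite mulr_ge0 ?ler0n// => /(_ isT)/andP[le _].
  rewrite -(ltr_nat R); apply: le_lt_trans le _.
  by rewrite gtr_pMr.
pose g (n : 'I_(M ^ d).+1) : {ffun 'I_d -> 'I_M} :=
  [ffun i => Ordinal (bP n i)].
have [/injectiveP/leq_card|/injectivePn[k [l kl gkl]]] := boolP (injectiveb g).
  by rewrite card_ffun !card_ord ltnn.
have close : `|frac_rV (f l) - frac_rV (f k)| < M%:R^-1.
  apply: norm_rV_lt; first by rewrite invr_gt0.
  move=> i; have /ffunP/(_ i) := gkl; rewrite !ffunE => /(congr1 val) /= tE.
  have /andP[l0 _] := frac_rV_itv (f l) i.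
  have /andP[k0 _] := frac_rV_itv (f k) i.
  have /andP := @truncn_itv _ (M%:R * frac_rV (f k) 0 i) (mulr_ge0 (ltW M0R) k0).
  have /andP := @truncn_itv _ (M%:R * frac_rV (f l) 0 i) (mulr_ge0 (ltW M0R) l0).
  rewrite -/(b l i) -/(b k i) -tE -!natr1 => -[h1 h2] [h3 h4].
  rewrite [X in `|X|]mxE [X in _ + X]mxE -(ltr_pM2l M0R) mulfV ?gt_eqF//.
  rewrite -{1}(gtr0_norm M0R) -normrM mulrBr ltr_norml; apply/andP; lra.
have [lt|lt|/val_inj e] := ltngtP k l; last by rewrite e eqxx in kl.
  by exists k, l; split=> //; rewrite -ltnS.
by exists l, k; split=> //; [rewrite -ltnS | rewrite distrC].
Qed.

(** * Relative density of the products of powers *)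

(** For fixed [k], the products [A ^ i * B ^ (k + N - i)], [i <= N], climb from
[B ^ (k + N)] to [A ^ N * B ^ k] with ratio [A / B] at each step.  Once
[A ^ N >= B ^ N.+1], these chains overlap for consecutive [k], so together they
cover all large numbers with ratio at most [1 + eta]. *)
Lemma lacunary_chain (R : realType) (A B : nat) (eta : R) :
  (1 < B)%N -> (B < A)%N -> A%:R <= (1 + eta) * B%:R ->
  exists s0 : R, 0 < s0 /\ forall s, s0 <= s -> exists i j,
    s <= (A ^ i * B ^ j)%:R <= (1 + eta) * s.
Proof.
move=> B1 BA AB.
have B0 : 0 < B%:R :> R by rewrite ltr0n; lia.
have [N hN] : exists N, (B ^ N.+1 <= A ^ N)%N.
  (* Bernoulli: (A / B) ^ n >= (1 + 1 / B) ^ n >= 1 + n / B. *)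
  have ber n : (B ^ n * (B + n) <= A ^ n * B)%N.
    elim: n => [|n IH]; first by rewrite !expn0 addn0.
    have : (B.+1 * (B ^ n * (B + n)) <= A * (A ^ n * B))%N by exact: leq_mul.
    rewrite !expnS -(mulnA A); apply: leq_trans.
    by set y := (B ^ n)%N; nia.
  exists (B * B)%N; rewrite -(@leq_pmul2r B) ?expnS; last lia.
  by apply: leq_trans (ber _); set y := (B ^ _)%N; nia.
exists (B ^ N)%:R; split=> [|s sN]; first by rewrite ltr0n expn_gt0; lia.
have eta0 : 0 < 1 + eta.
  rewrite -(pmulr_lgt0 _ B0); apply: lt_le_trans AB; rewrite ltr0n; lia.
have s0 : 0 < s by apply: lt_le_trans sN; rewrite ltr0n expn_gt0; lia.
pose u k i := (A ^ i * B ^ (k + N - i))%N.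
have top k : (B ^ (k + N).+1 <= u k N)%N.
  rewrite /u addnK -addnS expnD mulnC leq_mul2r.
  by rewrite hN orbT.
have bot k : u k 0%N = (B ^ (k + N))%N by rewrite /u expn0 mul1n subn0.
have [k hk] : exists k, s <= (u k N)%:R.
  exists (Num.trunc s).+1.
  have /andP[_ /ltW le] := truncn_itv (ltW s0); apply: le_trans le _.
  rewrite ler_nat; apply: leq_trans (top _).
  apply: leq_trans (ltnW (ltn_expl _ B1)) _.
  by rewrite leq_exp2l //; lia.
have [{hk}k hk kmin] := ex_minnP (ex_intro (fun k => s <= (u k N)%:R) k hk).
have lo : (u k 0%N)%:R <= s.
  rewrite bot; case: k hk kmin => [|k] hk kmin; first by rewrite add0n.
  rewrite leNgt; apply/negP => lt.
  suff : (k < k)%N by rewrite ltnn.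
  apply: kmin; apply: ltW; apply: lt_le_trans lt _.
  by rewrite ler_nat addSn; exact: top.
have [i hi imin] := ex_minnP (ex_intro (fun i => s <= (u k i)%:R) N hk).
have iN : (i <= N)%N by exact: imin.
exists i, (k + N - i)%N; rewrite -/(u k i) hi /=.
case: i hi imin iN => [|i] hi imin iN.
  have {hi}-> : s = (u k 0%N)%:R by apply/le_anti; rewrite hi lo.
  rewrite ler_peMl ?ler0n//; rewrite -(ler_pM2r B0) mul1r.
  by apply: le_trans AB; rewrite ler_nat ltnW.
have lt : (u k i)%:R < s.
  by rewrite ltNge; apply/negP => /imin; rewrite ltnn.
apply: le_trans (_ : (1 + eta) * (u k i)%:R <= _); last first.
  by rewrite ler_pM2l // ltW.
rewrite /u (_ : (k + N - i = (k + N - i.+1).+1)%N); last lia.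
rewrite !expnS !natrM; set x := (A ^ i)%:R; set y := (B ^ _)%:R.
have xy : 0 <= x * y by rewrite mulr_ge0 ?ler0n.
by have := ler_wpM2r xy AB; congr (_ <= _); ring.
Qed.

Lemma mult_independentX p q a : (0 < a)%N ->
  mult_independent p q -> mult_independent (p ^ a) (q ^ a).
Proof.
move=> a0 ind [b [c [b0 c0 e]]]; apply: ind; exists (a * b)%N, (a * c)%N.
by rewrite !muln_gt0 a0 b0 c0 !expnM.
Qed.

(** The integers [p ^ i * q ^ j] become relatively dense.  Among the ratios
[p ^ k / q ^ c k], which lie in the interval from 1 to [q], two are close, and
they differ by independence; their quotient is a fraction [A / B] slightly
larger or smaller than 1, to which [lacunary_chain] applies. *)
Lemma lacunary (R : realType) p q (eta : R) :
  (1 < p)%N -> (1 < q)%N -> mult_independent p q -> 0 < eta ->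
  exists s0 : R, 0 < s0 /\ forall s, s0 <= s -> exists i j,
    s <= (p ^ i * q ^ j)%:R <= (1 + eta) * s.
Proof.
move=> p1 q1 ind eta_gt0.
wlog eta1 : eta eta_gt0 / eta < 1 => [hw|].
  have [|//|s0 [s0_gt0 hs]] := hw (Num.min eta 2^-1); rewrite ?gt_min ?invf_lt1 ?ltr1n ?orbT//.
    by rewrite lt_min eta_gt0 invr_gt0 ltr0n.
  exists s0; split=> // s ss0; have [i [j /andP[h1 h2]]] := hs s ss0.
  exists i, j; rewrite h1 /=; apply: le_trans h2 _.
  by rewrite ler_pM2r ?lerD2l ?ge_min ?lexx// (lt_le_trans s0_gt0).
have q0 : 0 < q%:R :> R by rewrite ltr0n; lia.
pose c k := trunc_log q (p ^ k).
pose r k : R := (p ^ k)%:R / (q ^ c k)%:R.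
have qX_gt0 n : 0 < (q ^ n)%:R :> R by rewrite ltr0n expn_gt0; lia.
have pX_gt0 n : (0 < p ^ n)%N by rewrite expn_gt0; lia.
have r1 k : 1 <= r k.
  by rewrite ler_pdivlMr // mul1r ler_nat trunc_logP.
have rq k : r k / q%:R < 1.
  rewrite ltr_pdivrMr // mul1r ltr_pdivrMr // -natrM ltr_nat -expnS.
  by have /andP[] := trunc_log_bounds q1 (pX_gt0 k).
pose M := (Num.trunc (q%:R / eta)).+1.
have MP : M%:R^-1 < eta / q%:R.
  rewrite -[ltRHS]invf_div ltf_pV2 ?posrE ?divr_gt0// ?ltr0n//.
  by have /andP[] := truncn_itv (ltW (divr_gt0 q0 eta_gt0)).
have [k [l [kl _]]] :=
  @pigeonhole_frac R 1 M (fun k => const_mx (r k / q%:R)) isT.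
have fracE k' : frac_rV (const_mx (r k' / q%:R)) = const_mx (r k' / q%:R) :> 'rV_1.
  apply/rowP => i; rewrite !mxE (floor_def (m := 0)) ?subr0 //.
  by rewrite rq divr_ge0 ?ler0n // (le_trans ler01).
rewrite !fracE => /(le_lt_trans (coord_le_norm _ 0)).
rewrite !mxE -mulrBl normrM normfV (gtr0_norm q0) => h.
have {h MP} : `|r l - r k| < eta.
  by rewrite -(ltr_pM2r (x := q%:R^-1)) ?invr_gt0//; apply: lt_trans h MP.
have ckl : (c k <= c l)%N.
  by apply: leq_trunc_log; rewrite leq_exp2l // ltnW.
pose A := (p ^ (l - k))%N; pose B := (q ^ (c l - c k))%N.
have A1 : (1 < A)%N by rewrite -(exp1n (l - k)) ltn_exp2r ?subn_gt0.
have B0 : (0 < B)%N by rewrite expn_gt0; lia.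
have B0R : 0 < B%:R :> R by rewrite ltr0n.
have A0R : 0 < A%:R :> R by rewrite ltr0n ltnW.
have rE : r l * B%:R = r k * A%:R.
  have -> : r l = (p ^ k)%:R * A%:R / ((q ^ c k)%:R * B%:R).
    by rewrite -!natrM -!expnD !subnKC // ltnW.
  by rewrite /r; field; rewrite !gt_eqF.
rewrite ltr_norml => /andP[h1 h2].
have [AB|BA|AB] := ltngtP A B.
- have [|s0 [s0_gt0 hs]] := @lacunary_chain R B A eta A1 AB.
    have := r1 l; have : r k * A%:R <= (r l + eta) * A%:R.
      by rewrite ler_pM2r //; lra.
    rewrite -rE; move: (r l) => x h x1.
    rewrite -(ler_pM2l (x := x)); last lra.
    apply: le_trans h _; rewrite mulrA ler_pM2r // mulrDr mulr1 lerD2l.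
    by rewrite ler_peMl // ltW.
  exists s0; split=> // s /hs [i [j ij]].
  by exists ((l - k) * j)%N, ((c l - c k) * i)%N; rewrite !expnM mulnC.
- have AeB : A%:R <= (1 + eta) * B%:R.
    have := r1 k; have : r l * B%:R <= (r k + eta) * B%:R.
      by rewrite ler_pM2r //; lra.
    rewrite rE; move: (r k) => x h x1.
    rewrite -(ler_pM2l (x := x)); last lra.
    apply: le_trans h _; rewrite mulrA ler_pM2r // mulrDr mulr1 lerD2l.
    by rewrite ler_peMl // ltW.
  have [|s0 [s0_gt0 hs]] := @lacunary_chain R A B eta _ BA AeB.
    rewrite ltn_neqAle B0 andbT; apply: contraTneq AeB => <-.
    rewrite mulr1 -ltNge; have : 2 <= A%:R :> R by rewrite ler_nat.
    lra.
  exists s0; split=> // s /hs [i [j ij]].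
  by exists ((l - k) * i)%N, ((c l - c k) * j)%N; rewrite !expnM.
- case: ind; have [e|] := posnP (c l - c k).
    by rewrite AB /B e in A1.
  by move=> ?; exists (l - k)%N, (c l - c k)%N; split=> //; rewrite subn_gt0.
Qed.

(** * Small differences and torsion differences in invariant sets *)

(** Subsets of the torus are represented by their preimages in R^d: a closed
invariant set of the torus is a closed [X] with [periodic X], [stable p X] and
[stable q X]. *)
Definition periodic (R : realType) d (X : set 'rV[R]_d) :=
  forall x z, integral_rV z -> X x -> X (x + z).

Definition stable (R : realType) d a (X : set 'rV[R]_d) :=
  forall x, X x -> X (a%:R *: x).

Definition torsion_point (R : realType) d (x : 'rV[R]_d) :=
  exists2 N, (0 < N)%N & integral_rV (N%:R *: x).

Lemma stableM (R : realType) d a b (X : set 'rV[R]_d) :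
  stable a X -> stable b X -> stable (a * b) X.
Proof. by move=> sa sb x Xx; rewrite natrM -scalerA; apply/sa/sb. Qed.

Lemma stableX (R : realType) d a n (X : set 'rV[R]_d) :
  stable a X -> stable (a ^ n) X.
Proof.
move=> sa; elim: n => [|n IH]; first by move=> x; rewrite expn0 scale1r.
by rewrite expnS; exact: stableM.
Qed.

Lemma periodic_frac (R : realType) d (X : set 'rV[R]_d) x :
  periodic X -> X x -> X (frac_rV x).
Proof.
move=> per Xx; rewrite -[frac_rV x](subrK x) addrC.
exact: (per _ _ (frac_rV_int x)).
Qed.

(** If the points [P ^ n * x] are not all distinct modulo Z^d, then [x] is a
torsion point; if they are, two of them are close by the pigeonhole
principle. *)
Lemma small_difference (R : realType) d P (X : set 'rV[R]_d) x (e : R) :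
  (1 < P)%N -> periodic X -> stable P X ->
  X x -> ~ torsion_point x -> 0 < e ->
  exists y z, [/\ X y, X z & 0 < `|z - y| < e].
Proof.
move=> P1 per st Xx ntx e0; pose M := (Num.trunc e^-1).+1.
have ei0 : 0 < e^-1 by rewrite invr_gt0.
have Me : M%:R^-1 < e.
  rewrite invf_plt ?posrE ?ltr0n//.
  by have /andP[] := truncn_itv (ltW ei0).
have [k [l [kl _ close]]] :=
  @pigeonhole_frac R d M (fun n => (P ^ n)%:R *: x) isT.
have fX n : X (frac_rV ((P ^ n)%:R *: x))
  by apply: periodic_frac => //; apply: (stableX n st).
exists (frac_rV ((P ^ k)%:R *: x)), (frac_rV ((P ^ l)%:R *: x)); split=> //.
rewrite (lt_trans close Me) andbT normr_gt0 subr_eq0.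
apply/eqP => fE; apply: ntx; exists (P ^ l - P ^ k)%N.
  by rewrite subn_gt0 ltn_exp2l.
rewrite natrB ?leq_exp2l ?(ltnW kl)// scalerBl.
exact: frac_rV_inj.
Qed.

Lemma rV_int_divX d t (c : 'rV[int]_d) : (1 < t)%N -> c != 0 ->
  exists j (c' : 'rV[int]_d) i,
    c = (t ^ j)%:R *: c' /\ ~~ (t%:Z %| c' 0%R i)%Z.
Proof.
move=> t1 c0; have [i ci] : exists i, c 0 i != 0.
  apply/existsP; apply: contraNT c0 => /existsPn c0; apply/eqP/rowP => i.
  by rewrite mxE; apply/eqP; have := c0 i; rewrite negbK.
have [n] := ubnP `|c 0%R i|%N; elim: n c ci {c0} => // n IH c ci cn.
have [/forallP tc|/forallPn[k]] := boolP [forall k, (t%:Z %| c 0%R k)%Z]; last first.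
  by move=> tk; exists 0%N, c, k; rewrite expn0 scale1r.
pose c1 : 'rV[int]_d := \row_k (c 0%R k %/ t%:Z)%Z.
have cE : c = t%:R *: c1.
  by apply/rowP => k; rewrite !mxE mulrC natz divzK.
have ciE : c 0 i = t%:R * c1 0 i by rewrite cE !mxE.
have c1i : c1 0 i != 0.
  by apply: contraNneq ci => c10; rewrite ciE c10 mulr0.
have [|j [c' [k [c1E tk]]]] := IH c1 c1i.
  rewrite -ltnS; apply: leq_ltn_trans cn; rewrite ciE natz abszM absz_nat.
  by have : (0 < `|c1 0%R i|)%N; [rewrite absz_gt0 | nia].
by exists j.+1, c', k; split=> //; rewrite cE c1E scalerA expnS natrM.
Qed.

(** Some multiple of a small difference [u] of points of [X] is close to
[c / t], with [c] not divisible by [t].  With [m] at most [K = M ^ d],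
Dirichlet puts [m * u / |u|] within [1 / M] of an integral vector
[t ^ j * c], so [s * u], for [s = m / (|u| * t ^ j.+1)], is within [1 / M] of
[c / t].  As [|c / t| >= 1 / t] and [M >= 2 * t], [s] is large when [u] is
small, and [lacunary] replaces [s] by some [p ^ a * q ^ b] at a cost of at
most [1 / M], because [s * |u| <= K]. *)
Lemma torsion_difference_approx (R : realType) d p q t (X : set 'rV[R]_d) x (e : R) :
  (1 < p)%N -> (1 < q)%N -> mult_independent p q -> (1 < t)%N ->
  periodic X -> stable p X -> stable q X ->
  X x -> ~ torsion_point x -> 0 < e ->
  exists (c : 'rV[int]_d) i y z, [/\ ~~ (t%:Z %| c 0%R i)%Z, X y, X z &
    `|z - y - t%:R^-1 *: map_mx intr c| < e].
Proof.
move=> p1 q1 ind t1 per sp sq Xx ntx e0.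
have t0 : 0 < t%:R :> R by rewrite ltr0n ltnW.
pose M := maxn (Num.trunc (2 / e)).+1 (2 * t).
have M0 : (0 < M)%N by rewrite leq_max.
have Mi0 : 0 < M%:R^-1 :> R by rewrite invr_gt0 ltr0n.
have Me : 2 * M%:R^-1 < e.
  rewrite ltr_pdivrMr ?ltr0n// mulrC -ltr_pdivrMr//.
  have /andP[_ /lt_le_trans] := truncn_itv (ltW (divr_gt0 (ltr0Sn R 1) e0)).
  by apply; rewrite ler_nat leq_maxl.
have Mt : M%:R^-1 <= (2 * t%:R)^-1 :> R.
  rewrite -natrM lef_pV2 ?posrE ?ltr0n //; last lia.
  by rewrite ler_nat leq_maxr.
have M1 : M%:R^-1 <= 1 :> R by rewrite invf_le1 ?ler1n ?ltr0n.
pose K := (M ^ d)%N.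
have K0 : 0 < K%:R :> R by rewrite ltr0n expn_gt0 M0.
have [s0 [s0_gt0 lac]] :=
  lacunary p1 q1 ind (divr_gt0 Mi0 K0 : 0 < M%:R^-1 / K%:R).
have r0 : 0 < (2 * t%:R * s0)^-1.
  by rewrite invr_gt0 mulr_gt0 // mulr_gt0 // ltr0n.
have [y [z [Xy Xz]]] := small_difference p1 per sp Xx ntx r0.
move uE : (z - y) => u /andP[u0 us].
have [k [l [kl lK vM]]] :=
  @pigeonhole_frac R d M (fun n => (n%:R / `|u|) *: u) M0.
set v := (_ - _ : 'rV[R]_d) in vM.
pose m := (l - k)%N.
have m1 : 1 <= m%:R :> R by rewrite ler1n subn_gt0.
have mK : m%:R <= K%:R :> R by rewrite ler_nat; rewrite /K /m; lia.
have : integral_rV ((m%:R / `|u|) *: u - v).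
  have := integralB (frac_rV_int ((k%:R / `|u|) *: u))
                    (frac_rV_int ((l%:R / `|u|) *: u)).
  congr integral_rV; rewrite /v /m natrB ?(ltnW kl)// mulrBl scalerBl.
  by apply/rowP => i; rewrite !mxE; ring.
move=> /integral_rVP [c cE].
have muE : `|(m%:R / `|u|) *: u| = m%:R.
  by rewrite normrZ normrM normfV normr_id normr_nat mulfVK // gt_eqF.
(* The sup norm of (m / |u|) * u is m >= 1, so it is not within 1 / M of 0. *)
have c0 : c != 0.
  apply/eqP => c0; move: cE; rewrite c0.
  have -> : map_mx intr 0 = 0 :> 'rV[R]_d by apply/rowP => i; rewrite !mxE.
  move/eqP; rewrite subr_eq0 => /eqP vE.
  by move: vM; rewrite -vE muE ltNge (le_trans M1 m1).
have [j [c' [i [ccE tc']]]] := rV_int_divX t1 c0.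
pose T : R := (t ^ j.+1)%:R.
have T1 : 1 <= T by rewrite ler1n expn_gt0 ltnW.
have T0 : 0 < T by lra.
pose s : R := m%:R / `|u| / T.
have close : `|s *: u - t%:R^-1 *: map_mx intr c'| < M%:R^-1.
  have -> : s *: u - t%:R^-1 *: map_mx intr c' = T^-1 *: v.
    have -> : v = (m%:R / `|u|) *: u - map_mx intr c.
      by rewrite -cE opprB addrC subrK.
    rewrite ccE /s /T expnS natrM; apply/rowP => h; rewrite !mxE.
    rewrite rmorphM /= rmorph_nat; field.
    by rewrite !gt_eqF // ltr0n expn_gt0 ltnW.
  rewrite normrZ gtr0_norm ?invr_gt0// mulrC ltr_pdivrMr //.
  by apply: lt_le_trans vM _; rewrite ler_peMr // ltW.
have s_gt0 : 0 < s by rewrite !divr_gt0 //; lra.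
have suE : s * `|u| = m%:R / T.
  by rewrite /s; field; rewrite !gt_eqF.
have c'1 : t%:R^-1 <= `|t%:R^-1 *: map_mx intr c' : 'rV[R]_d|.
  apply: le_trans (coord_le_norm _ i); rewrite !mxE normrM ger0_norm; last first.
    by rewrite invr_ge0 ltW.
  rewrite ler_peMr ?invr_ge0 ?(ltW t0)// norm_intr_ge1 ?intr_int//.
  by rewrite intr_eq0; apply: contraNneq tc' => ->; rewrite dvdz0.
have s0s : s0 <= s.
  have : (2 * t%:R)^-1 <= s * `|u|.
    have -> : (2 * t%:R)^-1 = t%:R^-1 - (2 * t%:R)^-1 :> R by field; rewrite gt_eqF.
    rewrite lerBlDl; apply: le_trans c'1 _.
    rewrite -(gtr0_norm s_gt0) -normrZ -lerBlDr.
    have cM := lt_le_trans close Mt; apply: le_trans (ltW cM).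
    by rewrite distrC; exact: lerB_dist.
  move=> h; rewrite -(ler_pM2r u0); apply: le_trans h; apply/ltW.
  rewrite mulrC -ltr_pdivlMr //; apply: lt_le_trans us _.
  by rewrite invfM.
have [a [b /andP[h1 h2]]] := lac s s0s.
set sigma := (_ * _)%N in h1 h2.
have sigmaX w : X w -> X (sigma%:R *: w).
  exact: (stableM (stableX a sp) (stableX b sq)).
exists c', i, (sigma%:R *: y), (sigma%:R *: z); split=> //; try exact: sigmaX.
rewrite -scalerBr uE -(subrK (s *: u) (sigma%:R *: u)) -addrA.
apply: le_lt_trans (ler_normD _ _) _.
apply: lt_trans Me; rewrite mulr_natl mulr2n ler_ltD //.
rewrite -scalerBl normrZ ger0_norm ?subr_ge0//.
apply: (@le_trans _ _ (M%:R^-1 / K%:R * s * `|u|)).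
  by rewrite ler_pM2r // lerBlDr addrC -[X in X + _]mul1r -mulrDl.
rewrite -mulrA suE -mulrA ger_pMr // ler_pdivrMl // mulr1.
by apply: le_trans mK; rewrite ler_pdivrMr // ler_peMr.
Qed.

(** * Compactness *)

Lemma closure_rVP (R : realType) d (X : set 'rV[R]_d) x :
  closure X x <-> forall e, 0 < e -> exists2 y, X y & `|x - y| < e.
Proof.
split=> [clx e e0|near B /nbhs_normP[e /= e0 eB]].
  have [y [Xy xy]] := clx _ (nbhsx_ballx x e e0).
  by exists y => //; move: xy; rewrite -ball_normE.
by have [y Xy xy] := near e e0; exists y; split=> //; exact: eB.
Qed.

(** Compactness of the torus: approximate solutions, modulo Z^d, accumulate. *)
Lemma torus_compact (R : realType) d (E : R -> set 'rV[R]_d) :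
  (forall e e', e <= e' -> E e `<=` E e') ->
  (forall e, periodic (E e)) -> (forall e, 0 < e -> E e !=set0) ->
  exists x, forall e, 0 < e -> exists2 y, E e y & `|x - y| < e.
Proof.
move=> Emono Eper Ene.
pose K : set 'rV[R]_d := [set v | forall i, `[0, 1]%classic (v ord0 i)].
have Kc : compact K.
  by apply: (@rV_compact R d (fun=> `[0, 1]%classic)) => i; exact: segment_compact.
pose F := filter_from [set e : R | 0 < e] (fun e => E e `&` K).
have FF : ProperFilter F.
  apply: filter_from_proper; last first.
    move=> e /= e0; have [x Ex] := Ene e e0; exists (frac_rV x); split.
      exact: periodic_frac.
    move=> i; have /andP[h0 h1] := frac_rV_itv x i.
    by rewrite /= in_itv /= h0 ltW.
  apply: filter_from_filter; first by exists 1 => /=.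
  move=> e e' /= e0 e'0; exists (Num.min e e'); first by rewrite /= lt_min e0.
  move=> x [Ex Kx]; split; split=> //; apply: Emono Ex.
    by rewrite ge_min lexx.
  by rewrite ge_min lexx orbT.
have FK : F K by exists 1 => /= [|x []//]; exact: ltr01.
have [x [_ clx]] := Kc F FF FK; exists x => e e0.
have FE : F (E e) by exists e => //= y [].
have [y [Ey xy]] := clx _ _ FE (nbhsx_ballx x e e0).
by exists y => //; move: xy; rewrite -ball_normE.
Qed.

Lemma finite_pigeonhole (R : realType) (I : finType) (Q : I -> R -> Prop) :
  (forall i e e', e <= e' -> Q i e -> Q i e') ->
  (forall e, 0 < e -> exists i, Q i e) ->
  exists i, forall e, 0 < e -> Q i e.
Proof.
move=> Qmono Qex; apply: contrapT => nQ.
have bad i : exists e, 0 < e /\ ~ Q i e.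
  apply: contrapT => ne; apply: nQ; exists i => e e0.
  by apply: contrapT => nQe; apply: ne; exists e.
pose f i := sval (cid (bad i)).
have fP i : 0 < f i /\ ~ Q i (f i) by exact: svalP (cid (bad i)).
have [|i Qi] := Qex (\big[Num.min/1]_i f i).
  by apply/bigmin_gtP; split=> [|i _]; [exact: ltr01 | exact: (fP i).1].
apply: (fP i).2; apply: Qmono Qi; exact: bigmin_le_cond.
Qed.

Lemma exact_difference (R : realType) d (X : set 'rV[R]_d) h :
  closed X -> periodic X ->
  (forall e, 0 < e -> exists y z, [/\ X y, X z & `|z - y - h| < e]) ->
  exists2 y, X y & X (y + h).
Proof.
move=> Xcl per near.
pose E (e : R) : set 'rV[R]_d :=
  [set y | X y /\ exists2 z, X z & `|z - y - h| < e].
have [||e e0|x Ex] := @torus_compact R d E.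
- move=> e e' ee' y [Xy [z Xz zy]]; split=> //; exists z => //.
  exact: lt_le_trans ee'.
- move=> e y w wi [Xy [z Xz zy]]; split; first exact: per.
  exists (z + w); first exact: per.
  by rewrite [y + w]addrC addrKA.
- by have [y [z [Xy Xz zy]]] := near e e0; exists y; split=> //; exists z.
exists x.
  by apply/Xcl/closure_rVP => e /Ex [y [Xy _] xy]; exists y.
apply/Xcl/closure_rVP => e e0.
have [y [Xy [z Xz zy]] xy] := Ex (e / 2) (divr_gt0 e0 (ltr0Sn R 1)).
exists z => //; have -> : x + h - z = (x - y) - (z - y - h).
  by apply/rowP => i; rewrite !mxE; ring.
by apply: le_lt_trans (ler_normB _ _) _; rewrite (splitr e) ltrD.
Qed.

Lemma int_of_near_int (R : realType) (x : R) :
  (forall e, 0 < e -> exists2 a, a \is a Num.int & `|x - a| < e) ->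
  x \is a Num.int.
Proof.
move=> near; have /andP[f0 f1] := floor_itv x; move: f0 f1.
rewrite intrD; set f := (Num.floor x)%:~R => f0 f1.
have [<-|fx] := eqVneq f x; first exact: intr_int.
have e0 : 0 < Num.min (x - f) (f + 1 - x).
  by rewrite lt_min !subr_gt0 f1 lt_neqAle fx f0.
have [a /intrP[m ->]] := near _ e0.
rewrite lt_min ltr_norml ltr_norml => /andP[/andP[h1 h2] /andP[h3 h4]].
have lt1 : (Num.floor x < m)%R by rewrite -(ltr_int R) -/f; lra.
have : (m < Num.floor x + 1)%R by rewrite -(ltr_int R) intrD -/f; lra.
by move: lt1; lia.
Qed.

Lemma integral_coordinate (R : realType) d (X : set 'rV[R]_d) i :
  closed X -> periodic X ->
  (forall e, 0 < e -> exists y a,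
    [/\ X y, a \is a Num.int & `|y 0 i - a| < e]) ->
  exists2 x, X x & x 0 i \is a Num.int.
Proof.
move=> Xcl per near.
pose E (e : R) : set 'rV[R]_d :=
  [set y | X y /\ exists2 a, a \is a Num.int & `|y 0 i - a| < e].
have [||e e0|x Ex] := @torus_compact R d E.
- move=> e e' ee' y [Xy [a ai ya]]; split=> //; exists a => //.
  exact: lt_le_trans ee'.
- move=> e y w wi [Xy [a ai ya]]; split; first exact: per.
  by exists (a + w 0 i); [rewrite rpredD | rewrite mxE [a + _]addrC addrKA].
- by have [y [a [Xy ai ya]]] := near e e0; exists y; split=> //; exists a.
exists x.
  by apply/Xcl/closure_rVP => e /Ex [y [Xy _] xy]; exists y.
apply: int_of_near_int => e e0.
have [y [Xy [a ai ya]] xy] := Ex (e / 2) (divr_gt0 e0 (ltr0Sn R 1)).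
exists a => //; rewrite (_ : x 0 i - a = (x 0 i - y 0 i) + (y 0 i - a)).
  apply: le_lt_trans (ler_normD _ _) _; rewrite (splitr e) ltrD //.
  by apply: le_lt_trans xy; have := coord_le_norm (x - y) i; rewrite !mxE.
by rewrite addrA subrK.
Qed.

(** Modulo Z^d only finitely many vectors [c / t] occur in
[torsion_difference_approx], so one of them is approximated
arbitrarily well by differences of points of [X], and compactness makes it a
difference. *)
Lemma torsion_difference (R : realType) d p q t (X : set 'rV[R]_d) x :
  (1 < p)%N -> (1 < q)%N -> mult_independent p q -> (1 < t)%N ->
  closed X -> periodic X -> stable p X -> stable q X ->
  X x -> ~ torsion_point x ->
  exists (c : 'rV[int]_d) i y, [/\ ~~ (t%:Z %| c 0%R i)%Z, X y &
    X (y + t%:R^-1 *: map_mx intr c)].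
Proof.
move=> p1 q1 ind t1 Xcl per sp sq Xx ntx.
pose vec (r : {ffun 'I_d -> 'I_t}) : 'rV[int]_d := \row_i (r i : nat)%:Z.
pose Q (r : {ffun 'I_d -> 'I_t}) (e : R) :=
  (exists i, ~~ (t%:Z %| (vec r) 0%R i)%Z) /\ exists y z,
    [/\ X y, X z & `|z - y - t%:R^-1 *: map_mx intr (vec r)| < e].
have [||r Qr] := @finite_pigeonhole R _ Q.
- move=> r e e' ee' [ri [y [z [Xy Xz zy]]]]; split=> //.
  by exists y, z; split=> //; exact: lt_le_trans ee'.
- move=> e e0.
  have [c [i [y [z [tc Xy Xz zy]]]]] := torsion_difference_approx p1 q1 ind t1 per sp sq Xx ntx e0.
  have t0 : t%:Z != 0 :> int by rewrite eqz_nat; lia.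
  have rt k : (`|(c 0%R k %% t%:Z)%Z|%N < t)%N.
    by have := ltz_mod (c 0 k) t0; have := modz_ge0 (c 0 k) t0; lia.
  have [r rE] : exists r, forall k, vec r 0 k = (c 0%R k %% t%:Z)%Z.
    exists [ffun k => Ordinal (rt k)] => k.
    by rewrite mxE ffunE /= gez0_abs // modz_ge0.
  exists r.
  split.
    exists i; rewrite rE; apply: contra tc => tr.
    by rewrite (divz_eq (c 0 i) t%:Z) rpredD // dvdz_mull.
  pose w : 'rV[int]_d := \row_k (c 0%R k %/ t%:Z)%Z.
  exists y, (z - map_mx intr w); split=> //.
    rewrite -scaleN1r; apply: per => //; apply: integralZ; last exact: integral_map.
    by rewrite rpredN rpred1.
  move: zy; congr (`|_| < e); apply/rowP => k.
  have := divz_eq (c 0 k) t%:Z; rewrite -rE !mxE => {1}->.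
  rewrite intrD intrM -pmulrn; field.
  by rewrite pnatr_eq0; lia.
have [i ri] := (Qr 1 ltr01).1.
have [|y Xy Xyh] := @exact_difference R d X (t%:R^-1 *: map_mx intr (vec r)) Xcl per.
  by move=> e /Qr[].
by exists (vec r), i, y.
Qed.

(** * Translation by torsion points *)

(** The set [T] encodes the [t]-torsion points [c / t], through [c] modulo [t].
All integral representatives [c] are allowed, so the group law of the torsion
points is the one of the vector space over ['F_t], without any choice of
representatives. *)
Definition translates_in (R : realType) d t (T : {set 'rV['F_t]_d})
    (X : set 'rV[R]_d) : set 'rV[R]_d :=
  [set x | forall c : 'rV[int]_d, map_mx intr c \in T ->
    X (x + t%:R^-1 *: map_mx intr c)].

Lemma closed_translates (R : realType) d t (T : {set 'rV['F_t]_d})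
    (X : set 'rV[R]_d) : closed X -> closed (translates_in T X).
Proof.
move=> Xcl x /closure_rVP near c cT.
apply/Xcl/closure_rVP => e /near [y yT xy].
exists (y + t%:R^-1 *: map_mx intr c); first exact: yT.
by rewrite [y + _]addrC addrKA.
Qed.

Lemma periodic_translates (R : realType) d t (T : {set 'rV['F_t]_d})
    (X : set 'rV[R]_d) : periodic X -> periodic (translates_in T X).
Proof. by move=> per x z zi xT c cT; rewrite addrAC; apply: per => //; exact: xT. Qed.

(** As [a] is 1 modulo [t], multiplication by [a] fixes the torsion points
[c / t] modulo Z^d. *)
Lemma stable_translates (R : realType) d t (T : {set 'rV['F_t]_d})
    (X : set 'rV[R]_d) a : (0 < t)%N -> a = 1 %[mod t] ->
  periodic X -> stable a X -> stable a (translates_in T X).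
Proof.
move=> t0 at1 per st x xT c cT.
have [b ab] : exists b : int, a%:Z = 1 + b * t%:Z.
  exists (divz a t - divz 1 t).
  have := divz_eq a t; have := divz_eq 1 t; rewrite !modz_nat at1; lia.
pose y := x + t%:R^-1 *: map_mx intr c.
have -> : a%:R *: x + t%:R^-1 *: map_mx intr c =
    a%:R *: y + map_mx intr (- b *: c).
  have aR : a%:R = 1 + b%:~R * t%:R :> R by rewrite pmulrn ab intrD intrM.
  apply/rowP => k; rewrite !mxE aR rmorphM /= rmorphN /=; field.
  by rewrite pnatr_eq0; lia.
by apply: per; [exact: integral_map | apply: st; exact: xT].
Qed.

(** Take [T] maximal such that [translates_in T X] is not empty.  If [y] and
[y + c / t] are in it, then [y] is also in the set attached to [T] together
with its translate by [c], so [T] is stable under translation by [c] and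
[y + n * c / t] is in [X] for all [n].  The points [w] and [z] are two
consecutive terms of this progression.  That their [i]-th coordinates are
distinct modulo Z guarantees that [i] is not a coordinate on which [X] is
already integral. *)
Lemma coordinate_near_int (R : realType) d p q t (X : set 'rV[R]_d) x :
  (1 < p)%N -> (1 < q)%N -> mult_independent p q -> prime t ->
  coprime p t -> coprime q t ->
  closed X -> periodic X -> stable p X -> stable q X ->
  X x -> (forall y, X y -> ~ torsion_point y) ->
  exists i w z, [/\ X w, X z, z 0 i - w 0 i \isn't a Num.int &
    exists2 a, a \is a Num.int & `|w 0 i - a| < t%:R^-1].
Proof.
move=> p1 q1 ind pt cp cq Xcl per sp sq Xx nt.
have t1 := prime_gt1 pt; have t0 := prime_gt0 pt.
have tR0 : 0 < t%:R :> R by rewrite ltr0n.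
pose good (T : {set 'rV['F_t]_d}) := `[< translates_in T X !=set0 >].
have good0 : good [set 0]%SET.
  apply/asboolP; exists x => c; rewrite inE => /eqP/rowP c0.
  apply: per => // k; rewrite !mxE; have := c0 k; rewrite !mxE => /eqP.
  rewrite -(dvdz_pcharf (pchar_Fp pt)) => /dvdzP[b ->].
  by rewrite intrM -pmulrn mulrC mulfK ?intr_int ?gt_eqF.
have [T /maxsetP[/asboolP[x0 x0T] Tmax] T0] := maxset_exists good0.
pose a := totient t; have a0 : (0 < a)%N by rewrite totient_gt0.
have expX1 b : (1 < b)%N -> (1 < b ^ a)%N.
  by move=> b1; rewrite -(exp1n a) ltn_exp2r.
have Tnt : ~ torsion_point x0.
  apply: nt; rewrite -[x0]addr0 -(scaler0 _ t%:R^-1) -(map_mx0 intr).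
  by apply: x0T; rewrite map_mx0 (fintype.subsetP T0) // inE.
have [c [i [y [tc yT ycT]]]] := @torsion_difference R d (p ^ a) (q ^ a) t
    (translates_in T X) x0 (expX1 p p1) (expX1 q q1)
    (mult_independentX a0 ind) t1
    (closed_translates Xcl) (periodic_translates per)
    (stable_translates t0 (Euler_exp_totient cp) per (stableX a sp))
    (stable_translates t0 (Euler_exp_totient cq) per (stableX a sq)) x0T Tnt.
pose r : 'rV['F_t]_d := map_mx intr c.
have Tr u : u \in T -> u + r \in T.
  move=> uT; rewrite -(Tmax (T :|: [set v + r | v in T])%SET); last exact: finset.subsetUl.
    by rewrite inE; apply/orP; right; apply/imsetP; exists u.
  apply/asboolP; exists y => b; rewrite inE => /orP[bT|/imsetP[v vT bE]].
    exact: yT.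
  have -> : y + t%:R^-1 *: map_mx intr b =
      (y + t%:R^-1 *: map_mx intr c) + t%:R^-1 *: map_mx intr (b - c).
    by rewrite map_mxB scalerBr addrA addrAC addrK.
  by apply: ycT; rewrite map_mxB bE addrK.
have Tn n : X (y + t%:R^-1 *: map_mx intr (c *+ n)).
  apply: yT; rewrite raddfMn /=.
  elim: n => [|n IH]; first by rewrite mulr0n (fintype.subsetP T0) // inE.
  by rewrite mulrSr; exact: Tr.
have ri : r 0 i != 0 by rewrite mxE -(dvdz_pcharf (pchar_Fp pt)).
pose f := Num.floor (t%:R * y 0 i).
(* Solving f + n * c_i = 0 modulo t makes the i-th coordinate of y + n * c / t
   equal to an integer plus the fractional part of t * y_i, divided by t. *)
pose j : 'F_t := - f%:~R / r 0 i; pose n : nat := j.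
have /dvdzP[b bE] : (t%:Z %| f + n%:Z * c 0%R i)%Z.
  rewrite (dvdz_pcharf (pchar_Fp pt)) intrD intrM -pmulrn natr_Zp.
  have -> : (c 0 i)%:~R = r 0 i by rewrite mxE.
  by rewrite divfK // subrr.
exists i, (y + t%:R^-1 *: map_mx intr (c *+ n)),
  (y + t%:R^-1 *: map_mx intr (c *+ n.+1)).
split=> //.
  rewrite !mxE !mulmxnE mulrS intrD.
  rewrite (_ : _ - _ = (c 0 i)%:~R / t%:R); last by ring.
  apply: contra tc => /intrP[m cm]; apply/dvdzP; exists m.
  by apply: (intr_inj (R := R)); rewrite intrM -cm -pmulrn divfK ?gt_eqF.
exists b%:~R; first exact: intr_int.
have /andP[f0 f1] := floor_itv (t%:R * y 0 i); move: f0 f1.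
rewrite -/f intrD => f0 f1.
have bR : f%:~R + n%:R * (c 0 i)%:~R = b%:~R * t%:R :> R.
  by rewrite [in RHS]pmulrn -intrM -bE intrD intrM -pmulrn.
rewrite !mxE mulmxnE rmorphMn /= -[_ *+ n]mulr_natl.
have -> : y 0 i + t%:R^-1 * (n%:R * (c 0 i)%:~R) - b%:~R =
    (t%:R * y 0 i - f%:~R) / t%:R.
  apply: (mulfI (x := t%:R)); first by rewrite gt_eqF.
  have -> : n%:R * (c 0 i)%:~R = b%:~R * t%:R - f%:~R :> R by rewrite -bR; ring.
  by field; rewrite gt_eqF.
rewrite ger0_norm ?divr_ge0 ?subr_ge0 ?ler0n // ltr_pdivrMr // mulVf ?gt_eqF//.
by rewrite ltrBlDl.
Qed.

(** * Torsion points in invariant sets and Bohr recurrence *)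

(** Restricting coordinates to be integral keeps [X] closed and invariant.  A
maximal set [Z] of coordinates that can be made integral at once exists because
there are finitely many; unless there is a torsion point,
[coordinate_near_int] for arbitrarily large [t] enlarges it. *)
Lemma torsion_point_in_invariant (R : realType) d p q (X : set 'rV[R]_d) :
  (1 < p)%N -> (1 < q)%N -> mult_independent p q ->
  closed X -> periodic X -> stable p X -> stable q X -> X !=set0 ->
  exists2 x, X x & torsion_point x.
Proof.
move=> p1 q1 ind Xcl per sp sq [x0 Xx0]; apply: contrapT => nt.
pose sub (Z : {set 'I_d}) : set 'rV[R]_d :=
  [set x | X x /\ forall i, i \in Z -> x 0 i \is a Num.int].
have sub0 : `[< sub finset.set0 !=set0 >].
  by apply/asboolP; exists x0; split=> // i; rewrite inE.
have [Z /maxsetP[/asboolP[x Zx] Zmax] _] :=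
  @maxset_exists _ (fun Z => `[< sub Z !=set0 >]) _ sub0.
have Zcl : closed (sub Z).
  move=> y /closure_rVP near; split.
    by apply/Xcl/closure_rVP => e /near [z [Xz _] yz]; exists z.
  move=> i iZ; apply: int_of_near_int => e /near [z [_ zZ] yz].
  exists (z 0 i); first exact: zZ.
  by apply: le_lt_trans yz; have := coord_le_norm (y - z) i; rewrite !mxE.
have Zper : periodic (sub Z).
  move=> y z zi [Xy yZ]; split; first exact: per.
  by move=> i iZ; rewrite mxE rpredD // yZ.
have Zst a : stable a X -> stable a (sub Z).
  move=> st y [Xy yZ]; split; first exact: st.
  by move=> i iZ; rewrite mxE rpredM ?yZ // natr_int.
have [||i iP] := @finite_pigeonhole R 'I_d (fun i e => i \notin Z /\
    exists y a, [/\ sub Z y, a \is a Num.int & `|y 0 i - a| < e]).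
- move=> i e e' ee' [iZ [y [a [Zy ai ya]]]]; split=> //.
  by exists y, a; split=> //; exact: lt_le_trans ee'.
- move=> e e0; have ei0 : 0 < e^-1 by rewrite invr_gt0.
  have [t tm pt] := prime_above (p + q + Num.trunc e^-1).
  have te : t%:R^-1 < e.
    rewrite invf_plt ?posrE ?ltr0n ?prime_gt0//.
    have /andP[_ /lt_le_trans] := truncn_itv (ltW ei0); apply.
    by rewrite ler_nat; apply: leq_trans tm; rewrite ltnS leq_addl.
  have cop a : (0 < a < t)%N -> coprime a t.
    by move=> /andP[a0 at1]; rewrite coprime_sym prime_coprime // gtnNdvd.
  have [|||i [w [z [Zw Zz zw [a ai wa]]]]] := @coordinate_near_int R d p q t _ x
    p1 q1 ind pt _ _ Zcl Zper (Zst p sp) (Zst q sq) Zx.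
  + by apply: cop; lia.
  + by apply: cop; lia.
  + by move=> y [Xy _] ty; apply: nt; exists y.
  exists i; split.
    by apply: contra zw => iZ; rewrite rpredB ?Zw.2 ?Zz.2.
  by exists w, a; split=> //; exact: lt_trans wa te.
have iZ : i \notin Z := (iP 1 ltr01).1.
have [e e0|y [Xy yZ] yi] := @integral_coordinate R d (sub Z) i Zcl Zper.
  exact: (iP e e0).2.
have/(_ _ _)/wrap[||Zi] := Zmax (i |: Z).
- apply/asboolP; exists y; split=> // k; rewrite in_setU1 => /orP[/eqP->//|].
  exact: yZ.
- exact: finset.subsetUr.
by move: iZ; rewrite -Zi setU11.
Qed.

Lemma dist_int_le (R : realType) (x : R) (z : int) :
  dist_int x <= `|x - z%:~R|.
Proof.
apply: ge_inf; last by exists z.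
by exists 0 => _ [w _ <-].
Qed.

Theorem theorem1 (R : realType) (p q : nat) (hp : (2 <= p)%N) (hq : (2 <= q)%N)
  (hpq : mult_independent p q) :
  bohr_recurrence R (fact_pow_set p q).
Proof.
move=> d alpha eps d0 eps0.
pose v : 'rV[R]_d := \row_j alpha j.
pose O : set 'rV[R]_d := [set x | exists m n z,
  [/\ (0 < m)%N, (0 < n)%N, integral_rV z & x = (p ^ m * q ^ n)%:R *: v + z]].
have Oper : periodic (closure O).
  move=> y z zi /closure_rVP cy; apply/closure_rVP => e e0.
  have [_ [m [n [z' [m0 n0 z'i ->]]]] yw] := cy e e0.
  exists ((p ^ m * q ^ n)%:R *: v + z' + z); last first.
    by rewrite [X in _ - X]addrC addrKA.
  by exists m, n, (z' + z); split=> //; [exact: integralD | rewrite addrA].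
have Ost a : (0 < a)%N -> (forall w, O w -> O (a%:R *: w)) -> stable a (closure O).
  move=> a0 Oa y /closure_rVP cy; have aR : 0 < a%:R :> R by rewrite ltr0n.
  apply/closure_rVP => e e0.
  have [w Ow yw] := cy (e / a%:R) (divr_gt0 e0 aR).
  exists (a%:R *: w); first exact: Oa.
  by rewrite -scalerBr normrZ gtr0_norm // mulrC -ltr_pdivlMr.
have Op : stable p (closure O).
  apply: Ost; first exact: ltnW.
  move=> _ [m [n [z [m0 n0 zi ->]]]]; exists m.+1, n, (p%:R *: z); split=> //.
    by apply: integralZ; rewrite ?natr_int.
  by rewrite scalerDr scalerA -natrM expnS mulnA.
have Oq : stable q (closure O).
  apply: Ost; first exact: ltnW.
  move=> _ [m [n [z [m0 n0 zi ->]]]]; exists m, n.+1, (q%:R *: z); split=> //.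
    by apply: integralZ; rewrite ?natr_int.
  by rewrite scalerDr scalerA -natrM expnS mulnCA.
have One : closure O !=set0.
  exists ((p ^ 1 * q ^ 1)%:R *: v); apply: subset_closure.
  by exists 1%N, 1%N, 0; split=> //; [move=> i; rewrite mxE | rewrite addr0].
have [y /closure_rVP cy [N N0 Ny]] := torsion_point_in_invariant
  hp hq hpq (@closed_closure _ O) Oper Op Oq One.
have F0 : 0 < N`!%:R :> R by rewrite ltr0n fact_gt0.
have [_ [m [n [z [m0 n0 zi ->]]]] yw] := cy (eps / N`!%:R) (divr_gt0 eps0 F0).
exists (N`! * p ^ m * q ^ n)%N; split.
- by exists N, m, n.
- by rewrite eqz_nat -lt0n !muln_gt0 fact_gt0 !expn_gt0 !(ltnW hp, ltnW hq).
move=> j.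
have [b bE] : exists b : int, b%:~R = N`!%:R * y 0 j - N`!%:R * z 0 j.
  suff /intrP[b ->] : N`!%:R * y 0 j - N`!%:R * z 0 j \is a Num.int by exists b.
  apply: rpredB; last by rewrite rpredM ?natr_int ?zi.
  have /dvdnP[b ->] : (N %| N`!)%N by rewrite dvdn_fact // N0 /=.
  by rewrite natrM -mulrA rpredM ?natr_int //; have := Ny j; rewrite mxE.
apply: le_trans (dist_int_le _ b) _; rewrite bE.
have := le_lt_trans (coord_le_norm _ j) yw; rewrite !mxE => /ltW.
rewrite ler_pdivlMr // mulrC -{1}(gtr0_norm F0) -normrM distrC.
by congr (`|_| <= _); rewrite -pmulrn -mulnA natrM; ring.
Qed.
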